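(* Let $A=(a_{ij})_{m\times n}$ have entries in $[0,1]$, let $b=(b_i)_{m\times 1}$ have entries in $[0,1]$, let $\lambda>0$ and $c=(c_1,\dots,c_n)\in\mathbb{R}^n$. Let $S$ be the solution set of the max-Dombi fuzzy relational system $A\varphi x=b$, and let $\bar{X}$, $\bar{E}$ and $\underline{X}(e)$ be as defined in the context. Put $c_j^+=\max\{c_j,0\}$ and $c_j^-=\min\{c_j,0\}$ for $j=1,\dots,n$. Suppose that $S\neq\emptyset$, that $\bar{X}$ is an optimal solution of the problem of minimizing $Z_2=\sum_{j=1}^n c_j^-x_j$ over $x\in S$, and that, for some $e^*\in\bar{E}$, $\underline{X}(e^* )$ is an optimal solution of the problem of minimizing $Z_1=\sum_{j=1}^n c_j^+x_j$ over $x\in S$. Define $x^*=[x_1^*,\dots,x_n^*]$ by $$x_j^*=\begin{cases}\bar{X}_j & \text{if } c_j\le 0,\\ \underline{X}(e^* )_j & \text{if } c_j>0,\end{cases}\qquad j=1,\dots,n.$$ Then $x^*$ is an optimal solution (with optimal objective value $c^Tx^*$) of the problem of minimizing $\sum_{j=1}^n c_jx_j$ over $x\in S$.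
   Context: Let $I=\{1,\dots,m\}$, $J=\{1,\dots,n\}$. For $\lambda>0$ the Dombi t-norm $\varphi:[0,1]^2\to[0,1]$ is $\varphi(x,y)=0$ if $x=0$ or $y=0$, and otherwise $$\varphi(x,y)=\left(1+\left[\left(\tfrac{1-x}{x}\right)^{\lambda}+\left(\tfrac{1-y}{y}\right)^{\lambda}\right]^{1/\lambda}\right)^{-1}.$$ For $x\in[0,1]^n$, the system $A\varphi x=b$ means $\max_{j\in J}\varphi(a_{ij},x_j)=b_i$ for all $i\in I$. Put $S=\{x\in[0,1]^n : A\varphi x=b\}$. An optimal solution of a minimization problem over $S$ is an element of $S$ at which the objective attains its minimum over $S$. For $i\in I$ let $J_i=\{j\in J : a_{ij}\ge b_i\}$. For $i\in I$ with $b_i\neq 0$ and $j\in J_i$ let $$V(b_i,a_{ij})=\left(1+\left[\left(\tfrac{1-b_i}{b_i}\right)^{\lambda}-\left(\tfrac{1-a_{ij}}{a_{ij}}\right)^{\lambda}\right]^{1/\lambda}\right)^{-1}.$$ For $i\in I$ define $\hat{x}_i\in[0,1]^n$ by: $(\hat{x}_i)_j=V(b_i,a_{ij})$ if $j\in J_i$ and $b_i\neq 0$; $(\hat{x}_i)_j=0$ if $j\in J_i$ and $a_{ij}>b_i=0$; $(\hat{x}_i)_j=1$ otherwise. Let $\bar{X}=\min_{i\in I}\hat{x}_i$ (componentwise minimum). For $i\in I$ and $j\in J_i$ define $\breve{x}_i(j)\in[0,1]^n$ by $\breve{x}_i(j)_k=V(b_i,a_{ik})$ if $b_i\neq 0$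 and $k=j$, and $\breve{x}_i(j)_k=0$ otherwise ($k\in J$). For a function $e$ on $I$ with $e(i)\in J_i$ for all $i\in I$, define $\underline{X}(e)\in[0,1]^n$ by $\underline{X}(e)_j=\max_{i\in I}\breve{x}_i(e(i))_j$ for $j\in J$. The matrix $\bar{A}=(\bar{a}_{ij})_{m\times n}$ is obtained from $A$ by setting $\bar{a}_{ij}=0$ whenever one of the following holds, and $\bar{a}_{ij}=a_{ij}$ otherwise: (I) $j\notin J_i$; (II) $j\in J_i$, $b_i\neq 0$, and there is $i'\in I$, $i'\neq i$, with $j\in J_{i'}$, $b_{i'}\neq 0$ and $V(b_{i'},a_{i'j})<V(b_i,a_{ij})$; (III) $j\in J_i$, $b_i\neq 0$, and there is $i'\in I$, $i'\neq i$, with $b_{i'}=0$ and $a_{i'j}>0$. Let $\bar{J}_i=\{j\in J : \bar{a}_{ij}\ge b_i\}$, and let $\bar{E}$ be the set of all functions $e:I\to\bigcup_{i\in I}\bar{J}_i$ with $e(i)\in\bar{J}_i$ for all $i\in I$. (One has $\bar{J}_i\subseteq J_i$, so $\underline{X}(e)$ is defined for $e\in\bar{E}$.) *)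

(* Defs.v *)
From HB Require Import structures.
From mathcomp Require Import all_boot all_order all_algebra.
From mathcomp Require Import all_classical all_reals all_analysis.

Set Implicit Arguments.
Unset Strict Implicit.
Unset Printing Implicit Defensive.

Import Order.TTheory GRing.Theory Num.Theory.

Local Open Scope classical_set_scope.
Local Open Scope ring_scope.

Definition dombi (R : realType) (lambda x y : R) : R :=
  if (x == 0) || (y == 0) then 0
  else (1 + (((1 - x) / x) `^ lambda + ((1 - y) / y) `^ lambda)
              `^ (lambda^-1))^-1.

Definition unit_box (R : realType) (m n : nat) : set 'M[R]_(m, n) :=
  [set M | forall i j, 0 <= M i j <= 1].

(** [dombi] is nonnegative, so 0 is neutral for the maximum. *)
Definition maxdombi (R : realType) (m n : nat) (lambda : R)
    (A : 'M[R]_(m, n)) (x : 'cV[R]_n) : 'cV[R]_m :=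
  \col_i \big[Num.max/0]_(j < n) dombi lambda (A i j) (x j 0).

Definition solutions (R : realType) (m n : nat) (lambda : R)
    (A : 'M[R]_(m, n)) (b : 'cV[R]_m) : set 'cV[R]_n :=
  [set x | unit_box x /\ maxdombi lambda A x = b].

Definition optimal_solution (R : realType) (T : Type) (f : T -> R)
    (S : set T) (x : T) : Prop :=
  S x /\ forall y, S y -> f x <= f y.

Definition optimal_value (R : realType) (T : Type) (f : T -> R)
    (S : set T) (v : R) : Prop :=
  (f @` S) v /\ lbound (f @` S) v.

(** This is J_i for the matrix [A]; it is also instantiated at [Abar]. *)
Definition Jset (R : realType) (m n : nat) (A : 'M[R]_(m, n))
    (b : 'cV[R]_m) (i : 'I_m) : {set 'I_n} :=
  [set j | b i 0 <= A i j]%SET.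

(** V(b, a), meant for 0 < b <= a <= 1. *)
Definition Vfun (R : realType) (lambda b a : R) : R :=
  (1 + (((1 - b) / b) `^ lambda - ((1 - a) / a) `^ lambda)
         `^ (lambda^-1))^-1.

Definition xhat (R : realType) (m n : nat) (lambda : R)
    (A : 'M[R]_(m, n)) (b : 'cV[R]_m) (i : 'I_m) : 'cV[R]_n :=
  \col_j
    if (j \in Jset A b i) && (b i 0 != 0) then Vfun lambda (b i 0) (A i j)
    else if [&& j \in Jset A b i, b i 0 < A i j & b i 0 == 0] then 0
    else 1.

(** The entries of [xhat] are at most 1, so 1 is neutral for the minimum. *)
Definition Xbar (R : realType) (m n : nat) (lambda : R)
    (A : 'M[R]_(m, n)) (b : 'cV[R]_m) : 'cV[R]_n :=
  \col_j \big[Num.min/1]_(i < m) xhat lambda A b i j 0.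

(** Meant for [j \in Jset A b i]. *)
Definition xbreve (R : realType) (m n : nat) (lambda : R)
    (A : 'M[R]_(m, n)) (b : 'cV[R]_m) (i : 'I_m) (j : 'I_n) : 'cV[R]_n :=
  \col_k if (b i 0 != 0) && (k == j) then Vfun lambda (b i 0) (A i k) else 0.

(** The entries of [xbreve] are nonnegative, so 0 is neutral for the maximum. *)
Definition Xunder (R : realType) (m n : nat) (lambda : R)
    (A : 'M[R]_(m, n)) (b : 'cV[R]_m) (e : {ffun 'I_m -> 'I_n}) : 'cV[R]_n :=
  \col_j \big[Num.max/0]_(i < m) xbreve lambda A b i (e i) j 0.

Definition Abar (R : realType) (m n : nat) (lambda : R)
    (A : 'M[R]_(m, n)) (b : 'cV[R]_m) : 'M[R]_(m, n) :=
  \matrix_(i, j)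
    if [|| j \notin Jset A b i,
           [&& j \in Jset A b i, b i 0 != 0 &
             [exists i' : 'I_m,
               [&& i' != i, j \in Jset A b i', b i' 0 != 0 &
                   Vfun lambda (b i' 0) (A i' j)
                     < Vfun lambda (b i 0) (A i j)]]] |
           [&& j \in Jset A b i, b i 0 != 0 &
             [exists i' : 'I_m,
               [&& i' != i, b i' 0 == 0 & 0 < A i' j]]]]
    then 0 else A i j.

(** The set of all e with e(i) in the index set J_i of the reduced matrix; the
    codomain restriction to the union of these index sets is automatic. *)
Definition Ebar (R : realType) (m n : nat) (lambda : R)
    (A : 'M[R]_(m, n)) (b : 'cV[R]_m) : {set {ffun 'I_m -> 'I_n}} :=
  [set e : {ffun 'I_m -> 'I_n} |
    [forall i, e i \in Jset (Abar lambda A b) b i]]%SET.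

(* Main.v *)
(** Every [e] in [Ebar] satisfies [Xunder e <= Xbar]: the reduction rules (II)
    and (III) discard exactly the pairs [(i, j)] with [b_i] nonzero for which
    [V(b_i, a_ij)] exceeds the bound some other row puts on the [j]-th
    coordinate.  Hence [x*] lies between the two solutions [Xunder e*] and
    [Xbar], and is a solution because the t-norm is monotone.  It minimizes both
    halves of [Z = Z_1 + Z_2] at once, since [x*] agrees with [Xunder e*] where
    [c_j^+] is nonzero and with [Xbar] where [c_j^-] is. *)

Require Import Defs.
From mathcomp Require Import all_boot all_order all_algebra.
From mathcomp Require Import all_classical all_reals all_analysis.

Set Implicit Arguments.
Unset Strict Implicit.
Unset Printing Implicit Defensive.

Import Order.TTheory GRing.Theory Num.Theory.

Local Open Scope classical_set_scope.
Local Open Scope ring_scope.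

Lemma addr1_powR_gt0 (R : realType) (t s : R) : 0 < 1 + t `^ s.
Proof. by rewrite (lt_le_trans ltr01) // lerDl powR_ge0. Qed.

Lemma dombi_ge0 (R : realType) (lambda x y : R) : 0 <= dombi lambda x y.
Proof. by rewrite /dombi; case: ifP => // _; rewrite invr_ge0 addr_ge0 ?powR_ge0. Qed.

(** The odds [(1 - y) / y = y^-1 - 1] decrease in [y], the powers preserve order on nonnegative
    reals, and the outer inverse reverses it back. The bound [z <= 1] keeps the odds nonnegative. *)
Lemma ler_dombi (R : realType) (lambda x y z : R) :
  0 <= lambda -> 0 <= y -> y <= z -> z <= 1 ->
  dombi lambda x y <= dombi lambda x z.
Proof.
move=> lam0 y0 yz z1; rewrite {1}/dombi; case: ifPn => [_|]; first exact: dombi_ge0.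
rewrite negb_or => /andP[x_neq0 y_neq0].
have y_gt0 : 0 < y by rewrite lt_def y_neq0.
have z_gt0 : 0 < z := lt_le_trans y_gt0 yz.
rewrite /dombi (negbTE x_neq0) (gt_eqF z_gt0) /=.
have odds_ge0 : 0 <= (1 - z) / z by rewrite divr_ge0 ?subr_ge0 // ltW.
have odds_le : (1 - z) / z <= (1 - y) / y.
  by rewrite !mulrBl !mul1r !divff ?gt_eqF // lerB // lef_pV2.
rewrite (lef_pV2 (addr1_powR_gt0 _ _) (addr1_powR_gt0 _ _)) lerD2l.
apply: ge0_ler_powR; rewrite ?invr_ge0 ?nnegrE ?addr_ge0 ?powR_ge0 //.
by rewrite lerD2l ge0_ler_powR // nnegrE (le_trans odds_ge0).
Qed.

Lemma ler_maxdombi (R : realType) (m n : nat) (lambda : R)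
    (A : 'M[R]_(m, n)) (x y : 'cV[R]_n) (i : 'I_m) :
  0 <= lambda -> unit_box x -> unit_box y -> (forall j, x j 0 <= y j 0) ->
  maxdombi lambda A x i 0 <= maxdombi lambda A y i 0.
Proof.
move=> lam0 x01 y01 xy.
(* An unrestricted [!mxE] diverges: it tests both sides for convertibility. *)
rewrite [leLHS]mxE [leRHS]mxE.
apply: le_bigmax2 => j _; apply: (ler_dombi _ lam0) => //.
  by have /andP[] := x01 j 0.
by have /andP[] := y01 j 0.
Qed.

(** Monotonicity squeezes each row value at [y] between those at [x] and [z], which both equal
    [b i 0]. *)
Lemma solutions_between (R : realType) (m n : nat) (lambda : R)
    (A : 'M[R]_(m, n)) (b : 'cV[R]_m) (x y z : 'cV[R]_n) :
  0 <= lambda -> solutions lambda A b x -> solutions lambda A b z ->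
  (forall j, x j 0 <= y j 0 <= z j 0) -> solutions lambda A b y.
Proof.
move=> lam0 [x01 xb] [z01 zb] xyz.
have xy j : x j 0 <= y j 0 by have /andP[] := xyz j.
have yz j : y j 0 <= z j 0 by have /andP[] := xyz j.
have y01 : unit_box y.
  move=> j k; rewrite (ord1 k).
  have /andP[x0 _] := x01 j 0; have /andP[_ z1] := z01 j 0.
  by rewrite (le_trans x0 (xy j)) (le_trans (yz j) z1).
split; first exact: y01.
apply/matrixP => i k; rewrite (ord1 k); apply/le_anti/andP; split.
  by rewrite -zb; exact: (ler_maxdombi A i lam0 y01 z01 yz).
by rewrite -xb; exact: (ler_maxdombi A i lam0 x01 y01 xy).
Qed.

(** No range condition on [u] and [v] is needed here or for the upper bound 1: [powR] is nonnegative
    at every real base. *)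
Lemma Vfun_ge0 (R : realType) (lambda u v : R) : 0 <= Vfun lambda u v.
Proof. by rewrite invr_ge0 addr_ge0 ?powR_ge0. Qed.

Lemma Vfun_le1 (R : realType) (lambda u v : R) : Vfun lambda u v <= 1.
Proof. by rewrite invf_le1 ?addr1_powR_gt0 // lerDl powR_ge0. Qed.

Lemma xhat_ge0 (R : realType) (m n : nat) (lambda : R) (A : 'M[R]_(m, n))
    (b : 'cV[R]_m) (i : 'I_m) (j : 'I_n) : 0 <= xhat lambda A b i j 0.
Proof. by rewrite mxE; case: ifP => _; [exact: Vfun_ge0 | case: ifP]. Qed.

Lemma Vfun_le_xhat (R : realType) (m n : nat) (lambda : R) (A : 'M[R]_(m, n))
    (b : 'cV[R]_m) (i i' : 'I_m) (j : 'I_n) :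
  0 < b i 0 -> j \in Jset (Abar lambda A b) b i ->
  Vfun lambda (b i 0) (A i j) <= xhat lambda A b i' j 0.
Proof.
move=> b_gt0; rewrite inE mxE.
(* A discarded entry is 0 and cannot reach [b i 0 > 0], so none of (I), (II), (III) applies to
   [(i, j)]. *)
case: ifPn => [_|]; first by rewrite leNgt b_gt0.
rewrite !negb_or negbK gt_eqF //= => /and3P[jJ noII noIII] _.
move: noII noIII; rewrite jJ /= => /existsPn/(_ i') noII /existsPn/(_ i') noIII.
(* Row [i] itself gives equality. For another row, the failure of (II) bounds a [Vfun] entry of
   [xhat] from below, the failure of (III) rules out the entry 0, and the remaining entry is 1. *)
rewrite mxE; have [->|i'i] := eqVneq i' i; first by rewrite jJ gt_eqF.
case: ifPn => [/andP[jJ' b'_neq0]|_].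
  by move: noII; rewrite i'i jJ' b'_neq0 /= -leNgt.
case: ifPn => [/and3P[_ b'a /eqP b'0]|_]; last exact: Vfun_le1.
by move: noIII; rewrite i'i b'0 eqxx -b'0 b'a.
Qed.

Lemma Xunder_le_Xbar (R : realType) (m n : nat) (lambda : R)
    (A : 'M[R]_(m, n)) (b : 'cV[R]_m) (e : {ffun 'I_m -> 'I_n}) (j : 'I_n) :
  unit_box b -> e \in Ebar lambda A b ->
  Xunder lambda A b e j 0 <= Xbar lambda A b j 0.
Proof.
move=> b01; rewrite inE => /forallP eJ; rewrite !mxE.
(* Comparing a maximum with a minimum reduces to pairs of rows; the neutral elements 0 and 1 add the
   boundary comparisons. *)
apply: bigmax_le => [|i _]; apply: le_bigmin => //.
- by move=> i _; exact: xhat_ge0.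
- by rewrite mxE; case: ifP => // _; exact: Vfun_le1.
- move=> i' _; rewrite mxE; case: ifP => [/andP[b_neq0 /eqP ->]|_]; last exact: xhat_ge0.
  apply: Vfun_le_xhat => //.
  by rewrite lt_def b_neq0; have /andP[] := b01 i 0.
Qed.

Theorem theorem2 (R : realType) (m n : nat) (A : 'M[R]_(m, n))
    (b : 'cV[R]_m) (lambda : R) (c : 'cV[R]_n)
    (hA : unit_box A) (hb : unit_box b) (hlambda : 0 < lambda)
    (hS : solutions lambda A b !=set0)
    (hXbar : optimal_solution
       (fun x : 'cV[R]_n => \sum_(j < n) Num.min (c j 0) 0 * x j 0)
       (solutions lambda A b) (Xbar lambda A b))
    (estar : {ffun 'I_m -> 'I_n}) (hestar : estar \in Ebar lambda A b)
    (hXunder : optimal_solution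
       (fun x : 'cV[R]_n => \sum_(j < n) Num.max (c j 0) 0 * x j 0)
       (solutions lambda A b) (Xunder lambda A b estar)) :
  let xstar : 'cV[R]_n :=
    \col_j if c j 0 <= 0 then Xbar lambda A b j 0
           else Xunder lambda A b estar j 0 in
  let Z : 'cV[R]_n -> R := fun x => \sum_(j < n) c j 0 * x j 0 in
  optimal_solution Z (solutions lambda A b) xstar /\
  optimal_value Z (solutions lambda A b) ((c^T *m xstar) 0 0).
Proof.
move=> xstar Z.
have [SXbar minXbar] := hXbar; have [SXunder minXunder] := hXunder.
have Sxstar : solutions lambda A b xstar.
  apply: (solutions_between (ltW hlambda) SXunder SXbar) => j.
  by rewrite [xstar j 0]mxE; case: ifP => _; rewrite lexx Xunder_le_Xbar.
have ZE x : Z x = \sum_(j < n) Num.max (c j 0) 0 * x j 0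
                + \sum_(j < n) Num.min (c j 0) 0 * x j 0.
  by rewrite -big_split; apply: eq_bigr => j _ /=; rewrite -mulrDl addr_max_min addr0.
have Zxstar : Z xstar =
    \sum_(j < n) Num.max (c j 0) 0 * Xunder lambda A b estar j 0
  + \sum_(j < n) Num.min (c j 0) 0 * Xbar lambda A b j 0.
  rewrite -big_split; apply: eq_bigr => j _ /=; rewrite [xstar j 0]mxE.
  (* The sign of [c j 0] makes one of the two coefficients vanish, namely the one paired with the
     vector that [xstar] does not use at [j]. *)
  by case: leP => _; rewrite mul0r ?add0r ?addr0.
have Zmin y : solutions lambda A b y -> Z xstar <= Z y.
  by move=> Sy; rewrite Zxstar ZE lerD ?minXunder ?minXbar.
split; first by split.
have -> : (c^T *m xstar) 0 0 = Z xstar.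
  by rewrite mxE; apply: eq_bigr => j _; rewrite [c^T 0 j]mxE.
by split; [exists xstar | move=> _ [y Sy <-]; exact: Zmin].
Qed.
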